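(* Let $v,r>0$ be real, let $\alpha>0$ be a real number that is not an integer, and let $m\in\{0,1,2,\ldots\}$. Then $$\frac{\Gamma(m+r+1)}{\Gamma(v+m+r)}\sum_{l=0}^m\frac{\Gamma(l-\alpha)}{\Gamma(l+1)}\frac{\Gamma(v+\alpha+r+m-l)}{\Gamma(r+1+m-l)}=\frac{\Gamma(\alpha+r+v)}{\Gamma(r)}\sum_{l=0}^m\frac{\Gamma(l-\alpha)}{\Gamma(l+1)}\frac{\Gamma(l+r)}{\Gamma(v+l+r)}.$$
   Context: $\Gamma$ is the Euler Gamma function, extended to $\mathbb{C}\setminus\{0,-1,-2,\ldots\}$ by $\Gamma(z+1)=z\Gamma(z)$. *)

(* Defs.v *)
From HB Require Import structures.
From mathcomp Require Import all_boot all_order all_algebra.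
From mathcomp Require Import all_classical all_reals all_analysis.
Set Implicit Arguments.
Unset Strict Implicit.
Unset Printing Implicit Defensive.
Import Order.TTheory GRing.Theory Num.Theory.
Local Open Scope classical_set_scope.
Local Open Scope ring_scope.

Definition euler_integral (R : realType) (x : R) : R :=
  \int[@lebesgue_measure R]_(t in `]0, +oo[) (t `^ (x - 1) * expR (- t)).

(* The least n such that 0 < x + n. *)
Definition gamma_shift (R : realType) (x : R) : nat :=
  if 0 < x then 0%N else (Num.truncn (- x)).+1.

(* The Gamma function on the real line: Euler's integral for 0 < x, and
   Gamma x = Gamma (x + n) / (x (x + 1) ... (x + n - 1)), which is the iterated
   functional equation Gamma (x + 1) = x * Gamma x, for x <= 0. The value at
   the poles 0, -1, -2, ... is 0 by the convention on division by zero. *)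
Definition Gamma (R : realType) (x : R) : R :=
  let n := gamma_shift x in
  euler_integral (x + n%:R) / \prod_(i < n) (x + i%:R).

(* Main.v *)
(** Euler's integral satisfies [Gamma (x + 1) = x Gamma x]: integrate by parts
    on [[1/(n+2), n+2]] and let [n] tend to infinity. Pulling the Gamma factors
    out of both sides leaves the same constant, and with [w = v + r] and rising
    factorials there remains the rational identity
      [1/(w)_m sum_(l<=m) (-a)_l (a+w)_(m-l) (r+m-l+1)_l / l!
         = sum_(l<=m) (-a)_l (r)_l / (l! (w)_l)],
    proved by induction on [m]: the left-hand summand satisfies a first-order
    recurrence in [m] up to a term that telescopes in [l]. *)

Require Import Defs.
From HB Require Import structures.
From mathcomp Require Import all_boot all_order all_algebra.
From mathcomp Require Import all_classical all_reals all_analysis.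
From mathcomp Require Import measurable_realfun.
From mathcomp Require Import ring lra.
Set Implicit Arguments.
Unset Strict Implicit.
Unset Printing Implicit Defensive.
Import Order.TTheory GRing.Theory Num.Theory.
Import numFieldNormedType.Exports.
Local Open Scope classical_set_scope.
Local Open Scope ring_scope.

(** * Rising factorials *)

Definition rising (R : pzRingType) (x : R) (n : nat) : R :=
  \prod_(i < n) (x + i%:R).

Lemma rising0 (R : pzRingType) (x : R) : rising x 0 = 1.
Proof. exact: big_ord0. Qed.

Lemma risingS (R : pzRingType) (x : R) n : rising x n.+1 = rising x n * (x + n%:R).
Proof. exact: big_ord_recr. Qed.

Lemma risingSl (R : pzRingType) (x : R) n : rising x n.+1 = x * rising (x + 1) n.
Proof.
rewrite /rising big_ord_recl addr0; congr (_ * _).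
by apply: eq_bigr => i _; rewrite /= /bump /= natrD addrA.
Qed.

Lemma risingD (R : pzRingType) (x : R) m n :
  rising x (m + n) = rising x m * rising (x + m%:R) n.
Proof.
elim: n => [|n IHn]; first by rewrite addn0 rising0 mulr1.
by rewrite addnS !risingS IHn mulrA natrD addrA.
Qed.

Lemma rising_gt0 (R : realFieldType) (x : R) n : 0 < x -> 0 < rising x n.
Proof.
by move=> x0; apply: prodr_gt0 => i _; rewrite ltr_wpDr.
Qed.

(** * The rational identity *)

Section Identity.
Variables (R : realFieldType) (a w r : R).

Let term (m l : nat) : R :=
  rising (- a) l * rising (a + w) (m - l) * rising (r + (m - l)%:R + 1) l / l`!%:R.

(* Found by creative telescoping (Zeilberger's method). *)
Let cert (m l : nat) : R :=
  if l is l'.+1 then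
    - (rising (- a) l * rising (a + w) (m.+1 - l) *
       rising (r + (m - l')%:R + 1) l' / l'`!%:R)
  else 0.

Let term_cert m l : (l <= m)%N ->
  term m.+1 l - (w + m%:R) * term m l = cert m l.+1 - cert m l.
Proof.
move=> lm; rewrite /term /cert subSn// subSS.
(* With [m = (m - l) + l] every rising factorial is expressed through [k = m - l] and [l]; once the
   common factors are split off, a rational identity remains. *)
have mE : m%:R = (m - l)%:R + l%:R :> R by rewrite -natrD subnK.
case: l lm mE => [|j] lm mE.
  by rewrite !subn0 !risingS !rising0 fact0; move: mE; rewrite subn0 => _; field.
have -> : (m - j)%N = (m - j.+1).+1 by rewrite subnSK.
rewrite mE; set k := (m - j.+1)%N.
rewrite factS natrM [rising (- a) j.+2]risingS [rising (a + w) k.+1]risingS.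
rewrite [rising (r + k.+1%:R + 1) j.+1]risingS [rising (r + k%:R + 1) j.+1]risingSl.
rewrite -!natr1.
have -> : r + k%:R + 1 + 1 = r + (k%:R + 1) + 1 by ring.
field.
by rewrite natr1 !pnatr_eq0 -lt0n fact_gt0.
Qed.

Lemma sum_rising m : 0 < w ->
  \sum_(0 <= l < m.+1)
     rising (- a) l * rising (a + w) (m - l) * rising (r + (m - l)%:R + 1) l / l`!%:R
  = rising w m *
    \sum_(0 <= l < m.+1) rising (- a) l * rising r l / (l`!%:R * rising w l).
Proof.
move=> w0; rewrite -[LHS]/(\sum_(0 <= l < m.+1) term m l).
elim: m => [|m IHm].
  by rewrite !big_nat1 /term !rising0 fact0; field.
(* Summing [term_cert] over [l <= m] telescopes; the lower boundary value [cert m 0] is 0. *)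
have step : \sum_(0 <= l < m.+1) term m.+1 l =
    (w + m%:R) * (\sum_(0 <= l < m.+1) term m l) + cert m m.+1.
  apply/eqP; rewrite addrC -subr_eq mulr_sumr -sumrB.
  rewrite -[eqbRHS]subr0 -[0]/(cert m 0) -(telescope_sumr (cert m))//.
  apply/eqP; rewrite !big_nat; apply: eq_bigr => l lm; exact: term_cert.
rewrite big_nat_recr//= step IHm [in RHS]big_nat_recr//= mulrDr.
rewrite [(w + m%:R) * _]mulrA [(w + m%:R) * _]mulrC -risingS -addrA; congr (_ + _).
(* The boundary value [cert m m.+1] and the new summand [term m.+1 m.+1] share the factor
   [rising (r + 1) m]; their cofactors combine to [(r + 1 + m) - (m + 1) = r], which turns it into
   [rising r m.+1]. *)
rewrite /term /cert !subnn !addr0 !rising0.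
rewrite (mulrCA (rising w _)) -[X in _ = X]mulrA.
rewrite [rising (r + 1) m.+1]risingS (risingSl r) factS natrM -!natr1.
have wn := lt0r_neq0 (rising_gt0 m.+1 w0).
field.
by rewrite wn natr1 !pnatr_eq0 -lt0n fact_gt0.
Qed.
End Identity.

(** * The functional equation of Euler's integral *)

Lemma powR_Mexp_le (R : realType) (x t : R) (k : nat) :
  x <= k%:R -> 1 <= t -> t `^ x * expR (- t) <= (k.+1)`!%:R / t.
Proof.
move=> xk t1; have t0 : 0 < t by exact: lt_le_trans t1.
rewrite expRN ler_pdivrMr ?expR_gt0// -mulrAC ler_pdivlMr//.
have h1 : t `^ x * t <= t ^+ k.+1.
  by rewrite exprSr ler_pM2r// -powR_mulrn ?(ltW t0)//; exact: ler_powR.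
apply: (le_trans h1).
have := expR_ge1Dxn k (ltW t0).
rewrite -ler_pdivrMl ?ltr0n ?fact_gt0// => h.
by rewrite mulrC; apply: le_trans h; rewrite lerDr.
Qed.

(** Boundary term of the integration by parts at the upper endpoint; the next lemma treats the lower
    one, where the power alone tends to 0. *)
Lemma cvgn_powR_Mexp (R : realType) (x : R) :
  (n.+2%:R : R) `^ x * expR (- n.+2%:R) @[n --> \oo] --> (0 : R).
Proof.
pose k := (Num.truncn x).+1.
have xk : x <= k%:R by exact/ltW/truncnS_gt.
apply: (@squeeze_cvgr _ _ _ _ (fun=> 0) (fun n => (k.+1)`!%:R * harmonic n)).
- near=> n; rewrite mulr_ge0 ?powR_ge0 ?expR_ge0//=.
  apply: (le_trans (powR_Mexp_le xk _)); first by rewrite ler1n.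
  by rewrite ler_pM2l ?ltr0n ?fact_gt0// lef_pV2 ?posrE ?ltr0n// ler_nat.
- exact: cvg_cst.
- rewrite -[X in _ --> X](mulr0 (k.+1)`!%:R); apply: cvgMr.
  exact: cvg_harmonic.
Unshelve. all: end_near. Qed.

Lemma cvgn_powRV_Mexp (R : realType) (x : R) : 0 < x ->
  (n.+2%:R^-1 : R) `^ x * expR (- n.+2%:R^-1) @[n --> \oo] --> (0 : R).
Proof.
move=> x0.
apply: (@squeeze_cvgr _ _ _ _ (fun=> 0) (fun n => (n.+2%:R^-1 : R) `^ x)).
- near=> n; rewrite mulr_ge0 ?powR_ge0 ?expR_ge0//=.
  by rewrite ler_piMr ?powR_ge0// expR_le1 oppr_le0 invr_ge0 ler0n.
- exact: cvg_cst.
- move/cvg_at_rightP: (powR_cvg0 x0); apply; split=> [n|].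
    by rewrite invr_gt0 ltr0n.
  have := @cvg_harmonic R; rewrite -cvg_shiftS /=; exact.
Unshelve. all: end_near. Qed.

Lemma bigcup_itvV (R : realType) :
  (\bigcup_n `[(n.+2%:R^-1 : R), n.+2%:R] = `]0, +oo[)%classic.
Proof.
apply/seteqP; split=> t /=.
  case=> n _ /=; rewrite !in_itv/= andbT => /andP[h _].
  by apply: lt_le_trans h; rewrite invr_gt0 ltr0n.
rewrite in_itv/= andbT => t0.
(* The index has to dominate both [t] and [t^-1]. *)
exists (maxn (Num.truncn t) (Num.truncn t^-1)) => //=; rewrite in_itv/=.
set n := maxn _ _.
have le_n (y : R) : (Num.truncn y <= n)%N -> y <= n.+2%:R.
  move=> yn; apply: (le_trans (ltW (truncnS_gt y))); rewrite ler_nat.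
  by rewrite ltnS ltnW.
rewrite le_n ?leq_maxl// andbT -[leRHS]invrK lef_pV2 ?posrE ?invr_gt0 ?ltr0n//.
by rewrite le_n ?leq_maxr.
Qed.

(** Monotone convergence along the increasing intervals. Starting at [n.+2] keeps each of them
    nondegenerate and away from 0, as integration by parts requires. *)
Lemma cvgn_integral_itvV (R : realType) (f : R -> R) :
  measurable_fun setT f -> (forall t, 0 <= f t) ->
  (\int[@lebesgue_measure R]_(t in `[(n.+2%:R^-1)%R, (n.+2%:R)%R]) (f t)%:E
     @[n --> \oo] -->
   \int[@lebesgue_measure R]_(t in `]0%R, +oo[) (f t)%:E)%E.
Proof.
move=> mf f0; rewrite -bigcup_itvV.
apply: ge0_nondecreasing_set_cvg_integral => //.
- apply/nondecreasing_seqP => n; rewrite subsetEset; apply: subset_itv; rewrite bnd_simp.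
    by rewrite lef_pV2 ?posrE ?ltr0n// ler_nat.
  by rewrite ler_nat.
- by move=> n; apply/measurable_EFinP; exact: measurable_funS (@subsetT _ _) mf.
- by move=> n x _; rewrite lee_fin.
Qed.

Lemma continuous_expRN (R : realType) : continuous (fun t : R => expR (- t)).
Proof.
move=> t; apply: (@continuous_comp _ _ _ -%R expR).
  exact: oppr_continuous.
exact: continuous_expR.
Qed.

Lemma integral_powR_Mexp_itv (R : realType) (x a b : R) : 0 < x -> 0 < a -> a < b ->
  (\int[@lebesgue_measure R]_(t in `[a, b]) (t `^ x * expR (- t))%:E =
   (a `^ x * expR (- a) - b `^ x * expR (- b))%:E +
   \int[@lebesgue_measure R]_(t in `[a, b])
     (x * (t `^ (x - 1) * expR (- t)))%:E)%E.
Proof.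
move=> x0 a0 ab; have b0 := lt_trans a0 ab.
have dpow y (t : R) : 0 < t -> derivable (@powR R ^~ y) t 1.
  by move=> t0; apply: derivable_powR; rewrite in_itv/= t0.
have cpow y (t : R) : 0 < t -> {for t, continuous (@powR R ^~ y)}.
  move=> /(dpow y) h; apply: differentiable_continuous; exact/derivable1_diffP.
have dexp (t : R) : is_derive t 1 (fun t => - expR (- t)) (expR (- t)).
  by apply: is_derive_eq; rewrite mulrN1 opprK.
have cexp := @continuous_expRN R.
have cNexp : continuous (fun t : R => - expR (- t)).
  by move=> t; apply: cvgN; exact: cexp.
have pos (t : R) : t \in `]a, b[ -> 0 < t.
  by rewrite in_itv/= => /andP[+ _]; exact: lt_trans.
have := @integration_by_parts R (@powR R ^~ x) (fun t => - expR (- t))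
  (fun t => x * t `^ (x - 1)) (fun t => expR (- t)) a b ab.
move=> ->.
- rewrite (_ : a `^ x * expR (- a) - b `^ x * expR (- b) =
    b `^ x * - expR (- b) - a `^ x * - expR (- a)); last by ring.
  have -> : (fun t => (x * t `^ (x - 1) * - expR (- t))%:E) =
            (fun t => - (x * (t `^ (x - 1) * expR (- t)))%:E)%E.
    by apply/funext => t; rewrite -EFinN mulrN mulrA.
  rewrite integral_ge0N ?oppeK// => t _.
  by rewrite lee_fin !mulr_ge0 ?powR_ge0 ?expR_ge0 ?ltW.
- apply: derivable_within_continuous => t; rewrite in_itv/= => /andP[ta _].
  apply: derivableM => //; apply: dpow; exact: lt_le_trans ta.
- split; first by move=> t /pos; exact: dpow.
  + by apply: cvg_at_right_filter; exact: cpow.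
  + by apply: cvg_at_left_filter; exact: cpow.
- by move=> t /pos t0; rewrite derive1E; apply: derive_val; exact: is_derive1_powR.
- by apply: continuous_subspaceT.
- split.
  + by move=> t _; exact: ex_derive.
  + by apply: cvg_at_right_filter; exact: cNexp.
  + by apply: cvg_at_left_filter; exact: cNexp.
- by move=> t _; rewrite derive1E derive_val.
Qed.

Lemma euler_integralD1 (R : realType) (x : R) : 0 < x ->
  euler_integral (x + 1) = x * euler_integral x.
Proof.
move=> x0; rewrite /euler_integral addrK /Rintegral.
pose h y (t : R) := t `^ y * expR (- t).
have h0 y t : 0 <= h y t by rewrite mulr_ge0 ?powR_ge0 ?expR_ge0.
have mh y : measurable_fun setT (h y).
  apply: measurable_funM; first exact: measurable_powR.
  by apply: continuous_measurable_fun; exact: continuous_expRN.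
(* The equation is proved for extended-real integrals. Should the integral be infinite, both
   real-valued sides are 0. *)
suff -> : (\int[@lebesgue_measure R]_(t in `]0%R, +oo[) (h x t)%:E =
    x%:E * \int[@lebesgue_measure R]_(t in `]0%R, +oo[) (h (x - 1) t)%:E)%E.
  case: (\int[_]_(t in _) _)%E => [z||] //=.
  - by rewrite gt0_muley ?lte_fin// mulr0.
  - by rewrite gt0_muleNy ?lte_fin// mulr0.
rewrite -ge0_integralZl_EFin//; last 3 first.
- by move=> t _; rewrite lee_fin.
- by apply/measurable_EFinP; apply: measurable_funS (mh _).
- exact: ltW.
have cv := cvgn_integral_itvV (mh x) (h0 x).
have mxh : measurable_fun setT (fun t => x * h (x - 1) t).
  by exact: measurable_funM.
have xh0 t : 0 <= x * h (x - 1) t by rewrite mulr_ge0// ltW.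
have cvx := cvgn_integral_itvV mxh xh0.
have lt_itv n : n.+2%:R^-1 < n.+2%:R :> R.
  by rewrite (@lt_trans _ _ 1) ?ltr1n// invf_lt1 ?ltr1n.
have nV0 n : 0 < n.+2%:R^-1 :> R by rewrite invr_gt0.
move: cv; rewrite /h.
rewrite (funext (fun n => integral_powR_Mexp_itv x0 (nV0 n) (lt_itv n))) => cv.
have cvb : ((n.+2%:R^-1 `^ x * expR (- n.+2%:R^-1) -
    n.+2%:R `^ x * expR (- n.+2%:R))%:E @[n --> \oo] --> (0%R : R)%:E)%E.
  apply: cvg_EFin; first exact: nearW.
  rewrite -[X in _ --> X](subrr 0); apply: cvgB; first exact: cvgn_powRV_Mexp.
  exact: cvgn_powR_Mexp.
(* The sum of the limits is defined since the boundary terms have the finite limit 0. *)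
have /cvgeD : (0%:E +? \int[@lebesgue_measure R]_(t in `]0%R, +oo[)
  (x * h (x - 1) t)%:E)%E by exact: fin_num_adde_defr.
move/(_ _ _ _ _ _ cvb cvx); rewrite add0e => cvs.
exact: (cvg_unique _ cv cvs).
Qed.

(** * The functional equation of [Gamma] on the real line *)

Lemma gamma_shiftD1 (R : realType) (x : R) : x <= 0 ->
  gamma_shift x = (gamma_shift (x + 1)).+1.
Proof.
move=> x0; rewrite /gamma_shift ltNge x0/=; congr _.+1.
case: ltP => x1; first by apply: truncn_def; rewrite ?mulr0n ?mulr1n; lra.
apply: truncn_def; have := @truncn_itv R (- (x + 1)).
by rewrite -!natr1 => h; lra.
Qed.

(** For [x <= 0] both sides use the same Euler integral, and the product for [x] has just the extra
    factor [x]. At negative integers both sides are 0 by the division convention. *)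
Lemma GammaD1 (R : realType) (x : R) : x != 0 -> Gamma (x + 1) = x * Gamma x.
Proof.
move=> xn0; have [x0|x0] := ltP 0 x.
  rewrite /Gamma /gamma_shift x0 addr_gt0//= !big_ord0 !divr1 !addr0.
  exact: euler_integralD1.
rewrite /Gamma (gamma_shiftD1 x0) big_ord_recl addr0 -natr1.
set n := gamma_shift _.
rewrite invfM mulrCA mulVKf// (addrC n%:R) addrA.
congr (_ / _); apply: eq_bigr => i _.
by rewrite /= /bump /= natrD addrA.
Qed.

Lemma rising1 (R : pzRingType) n : rising (1 : R) n = n`!%:R.
Proof.
elim: n => [|n IHn]; first by rewrite rising0.
by rewrite risingS IHn factS mulnC natrM -add1n natrD.
Qed.

Lemma GammaDn (R : realType) (x : R) (n : nat) :
  (forall i, x + i%:R != 0) -> Gamma (x + n%:R) = Gamma x * rising x n.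
Proof.
move=> xn0; elim: n => [|n IHn]; first by rewrite rising0 addr0 mulr1.
by rewrite -natr1 addrA GammaD1// IHn risingS mulrC mulrA.
Qed.

(** * Reduction of the Gamma sums to rising factorials *)

Theorem theorem1p3 (R : realType) (v r alpha : R) (m : nat)
  (hv : 0 < v) (hr : 0 < r) (halpha : 0 < alpha)
  (halphaZ : alpha \isn't a Num.int) :
  Gamma (m%:R + r + 1) / Gamma (v + m%:R + r) *
    \sum_(0 <= l < m.+1)
      Gamma (l%:R - alpha) / Gamma (l%:R + 1) *
      (Gamma (v + alpha + r + m%:R - l%:R) / Gamma (r + 1 + m%:R - l%:R))
  = Gamma (alpha + r + v) / Gamma r *
    \sum_(0 <= l < m.+1)
      Gamma (l%:R - alpha) / Gamma (l%:R + 1) *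
      (Gamma (l%:R + r) / Gamma (v + l%:R + r)).
Proof.
have pos_neq0 (x : R) : 0 < x -> forall i, x + i%:R != 0.
  by move=> x0 i; rewrite gt_eqF// ltr_wpDr.
have w0 : 0 < v + r by rewrite addr_gt0.
have s0 : 0 < alpha + (v + r) by rewrite addr_gt0.
(* Non-integrality of [alpha] keeps [l - alpha] off the zeros excluded in [GammaDn]. *)
have na0 i : - alpha + i%:R != 0.
  apply: contra halphaZ; rewrite addrC subr_eq0 => /eqP <-.
  exact: intr_nat.
have GA l : Gamma (l%:R - alpha) = Gamma (- alpha) * rising (- alpha) l.
  by rewrite addrC GammaDn.
(* [Gamma 1] stays symbolic: it occurs in the same way on both sides. *)
have G1 l : Gamma (l%:R + 1 : R) = Gamma 1 * l`!%:R.
  by rewrite addrC GammaDn ?rising1//; exact: pos_neq0.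
have Gr l : Gamma (l%:R + r) = Gamma r * rising r l.
  by rewrite addrC GammaDn//; exact: pos_neq0.
have Gw l : Gamma (v + l%:R + r) = Gamma (v + r) * rising (v + r) l.
  by rewrite addrAC GammaDn//; exact: pos_neq0.
have rn0 n : rising r n != 0 by rewrite gt_eqF// rising_gt0.
have wn0 n : rising (v + r) n != 0 by rewrite gt_eqF// rising_gt0.
have fn0 n : n`!%:R != 0 :> R by rewrite pnatr_eq0 -lt0n fact_gt0.
have -> : m%:R + r + 1 = m.+1%:R + r by rewrite -natr1 addrAC.
have -> : alpha + r + v = alpha + (v + r) by ring.
(* The denominator [rising r (m - l).+1] depends on [l]; completing it to [rising r m.+1] produces
   the third rising factor of [sum_rising]. *)
rewrite (eq_big_nat _ _ (F2 := fun l =>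
    Gamma (- alpha) / Gamma 1 * (Gamma (alpha + (v + r)) / Gamma r) /
      rising r m.+1 *
    (rising (- alpha) l * rising (alpha + (v + r)) (m - l) *
     rising (r + (m - l)%:R + 1) l / l`!%:R))); last first.
  move=> l; rewrite ltnS => /andP[_ lm].
  have -> : v + alpha + r + m%:R - l%:R = alpha + (v + r) + (m - l)%:R.
    by rewrite natrB//; ring.
  have -> : r + 1 + m%:R - l%:R = (m - l).+1%:R + r.
    by rewrite -natr1 natrB//; ring.
  rewrite GA G1 Gr GammaDn; last exact: pos_neq0.
  have -> : rising r m.+1 =
      rising r (m - l).+1 * rising (r + (m - l)%:R + 1) l.
    by rewrite -addrA natr1 -risingD addSn subnK.
  have q0 : rising (r + (m - l)%:R + 1) l != 0.
    by rewrite gt_eqF// rising_gt0// addr_gt0// ltr_wpDr.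
  rewrite [(Gamma 1 * _)^-1]invfM [(Gamma r * _)^-1]invfM.
  (* Inverse Gamma values become opaque, so [field] asks for no nonvanishing of [Gamma]. *)
  move: (Gamma 1)^-1 (Gamma r)^-1 => g1 gr.
  by field; rewrite q0 rn0 fn0.
under [in RHS]eq_big_nat => l _.
  rewrite GA G1 Gr Gw.
  have -> : Gamma (- alpha) * rising (- alpha) l / (Gamma 1 * l`!%:R) *
      (Gamma r * rising r l / (Gamma (v + r) * rising (v + r) l)) =
    Gamma (- alpha) / Gamma 1 * (Gamma r / Gamma (v + r)) *
    (rising (- alpha) l * rising r l / (l`!%:R * rising (v + r) l)).
    rewrite [(Gamma 1 * _)^-1]invfM [(Gamma (v + r) * _)^-1]invfM.
    by rewrite [(l`!%:R * _)^-1]invfM; ring.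
  over.
rewrite -!mulr_sumr sum_rising// Gr Gw.
move: (\sum_(0 <= l < m.+1) _) => S.
rewrite [(Gamma (v + r) * _)^-1]invfM.
(* The product [Gamma r * gr] appears on both sides and is never cancelled. *)
move: (Gamma 1)^-1 (Gamma r)^-1 (Gamma (v + r))^-1 => g1 gr gw.
by field; rewrite rn0 wn0.
Qed.
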